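(* Let $n\ge 1$ and let $X$ be a finite pure $n$-dimensional simplicial complex with connected links, equipped with the homogeneous weight function $m$. Assume that $X$ is $K$-regular in the following sense: every vertex $\{v\}\in X(0)$ is contained in exactly $K$ $n$-dimensional simplices of $X$, i.e. $m(\{v\})=n!\,K$. Assume that there is a constant $0<\lambda<1$ such that for every $0\le k\le n-1$ and every $\tau\in X(k-1)$, $\mathrm{Spec}((M')^+_{\tau,0})\subseteq[-\lambda,\lambda]\cup\{1\}$. Then for all pairwise disjoint sets $U_0,\dots,U_n\subseteq X(0)$, $$\left| |X(U_0,\dots,U_n)|-\frac{n!\,K}{|X(0)|^n}|U_0||U_1|\cdots|U_n|\right|\le C_n\,n!\,\lambda K\min_{0\le i<j\le n}\sqrt{|U_i||U_j|},$$ and $$\left|\frac{|X(U_0,\dots,U_n)|}{|X(n)|}-(n+1)!\,\frac{|U_0||U_1|\cdots|U_n|}{|X(0)|^{n+1}}\right|\le C_n\,(n+1)!\,\lambda\min_{0\le i<j\le n}\sqrt{\frac{|U_i||U_j|}{|X(0)|^2}},$$ where $$C_n=\sum_{k=0}^{n-1}\left((k+1)(k+2)^{n-k}-(k+1)^{n-k+1}\right).$$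
   Context: $X(k)$ denotes the set of simplices of $X$ with $k+1$ vertices, $X(-1)=\{\emptyset\}$; a vertex $v$ is identified with $\{v\}\in X(0)$. $X$ is pure $n$-dimensional if every simplex is contained in a simplex of $X(n)$. For $\tau\in X(k)$ the link $X_\tau$ is the complex with $\eta\in X_\tau(l)$ iff $\eta\in X(l)$ and $\tau\cup\eta\in X(k+l+1)$; $X_\emptyset=X$. ''Connected links'' means that for every $-1\le k\le n-2$ and every $\tau\in X(k)$ the one-skeleton of $X_\tau$ (the graph with vertices $X_\tau(0)$ and edges $X_\tau(1)$) is connected; in particular the one-skeleton of $X$ is connected. Homogeneous weight: for $-1\le k\le n$ and $\tau\in X(k)$, $m(\tau)=(n-k)!\,|\{\sigma\in X(n):\tau\subseteq\sigma\}|$. On the link, $m_\tau(\eta)=m(\tau\cup\eta)$. The weighted random walk operator $(M')^+_{\tau,0}$ acts on functions $\phi:X_\tau(0)\to\mathbb{R}$ by $$(M')^+_{\tau,0}\phi(v)=\sum_{u:\{u,v\}\in X_\tau(1)}\frac{m_\tau(\{u,v\})}{m_\tau(\{v\})}\phi(u).$$ For pairwise disjoint $U_0,\dots,U_n\subseteq X(0)$, $X(U_0,\dots,U_n)=\{\sigma\in X(n):|\sigma\cap U_i|=1\text{ for all }0\le i\le n\}$. *)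

(* Defs.v *)
From HB Require Import structures.
From mathcomp Require Import all_boot all_order all_algebra.
From mathcomp Require Import reals.

Set Implicit Arguments.
Unset Strict Implicit.
Unset Printing Implicit Defensive.

Import Order.TTheory GRing.Theory Num.Theory.

Local Open Scope ring_scope.

Section Complexes.
Variable V : finType.
Implicit Types (X : {set {set V}}) (s t tau : {set V}).

(* A complex contains the empty simplex, and a point x of V is a vertex of X
   only when [set x] \in X. *)
Definition simplicial_complex X : Prop :=
  set0 \in X /\ forall s t, t \in X -> s \subset t -> s \in X.

(* Faces are indexed by their number of vertices: X(k) is faces X k.+1 and
   X(-1) is faces X 0. *)
Definition faces X (j : nat) : {set {set V}} := [set s in X | #|s| == j].

Definition vertices X : {set V} := [set v | [set v] \in faces X 1].

Definition pure_dim X (n : nat) : Prop :=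
  forall s, s \in X -> exists2 t, t \in faces X n.+1 & s \subset t.

(* The condition on cardinals makes eta disjoint from tau. *)
Definition link X tau : {set {set V}} :=
  [set eta in X | tau :|: eta \in faces X (#|tau| + #|eta|)].

Definition adjacent X : rel V := fun u v => [set u; v] \in faces X 2.

Definition connected_skeleton X : Prop :=
  forall u v, u \in vertices X -> v \in vertices X -> connect (adjacent X) u v.

(* tau ranges over X(-1), ..., X(n-2). *)
Definition connected_links X (n : nat) : Prop :=
  forall k, (k < n)%N -> forall tau, tau \in faces X k ->
  connected_skeleton (link X tau).

(* If tau is in X(k) then #|tau| = k + 1, so n + 1 - #|tau| = n - k. *)
Definition weight X (n : nat) tau : nat :=
  ((n.+1 - #|tau|)`! * #|[set s in faces X n.+1 | tau \subset s]|)%N.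

Definition link_weight X (n : nat) tau eta : nat := weight X n (tau :|: eta).

Definition regular_complex X (n K : nat) : Prop :=
  forall v, v \in vertices X -> #|[set s in faces X n.+1 | v \in s]| = K.

Definition transversal_faces X (n : nat) (U : 'I_n.+1 -> {set V}) :
    {set {set V}} :=
  [set s in faces X n.+1 | [forall i, #|s :&: U i| == 1%N]].

Definition link_vertex X tau : finType := {v : V | v \in vertices (link X tau)}.

Section Walk.
Variables (R : realType) (X : {set {set V}}) (n : nat) (tau : {set V}).

Definition walk (phi : {ffun link_vertex X tau -> R^o}) :
    {ffun link_vertex X tau -> R^o} :=
  [ffun v => \sum_(u | [set val u; val v] \in faces (link X tau) 2)
     (link_weight X n tau [set val u; val v])%:R
       / (link_weight X n tau [set val v])%:R * phi u].

Fact walk_is_linear : linear walk.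
Proof.
move=> a f g; apply/ffunP=> v; rewrite !ffunE scaler_sumr -big_split /=.
apply: eq_bigr => u _; rewrite !ffunE mulrDr; congr (_ + _).
by rewrite /GRing.scale /= mulrCA.
Qed.

HB.instance Definition _ := GRing.isLinear.Build R _ _ _ walk walk_is_linear.

End Walk.

(* The walk operator is self-adjoint for the inner product weighted by
   link_weight, so its whole spectrum is real and consists of the (real)
   eigenvalues. *)
Definition walk_spectrum (R : realType) X (n : nat) tau (a : R) : bool :=
  passmx.leigenvalue (linfun (@walk R X n tau)) a.

End Complexes.

Definition mixing_constant (R : realType) (n : nat) : R :=
  \sum_(k < n) (k.+1%:R * k.+2%:R ^+ (n - k) - k.+1%:R ^+ (n - k + 1)).

(* The minimum of F i j over 0 <= i < j <= n, for n >= 1: the initial value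
   F ord0 ord_max of the iteration is then one of the terms. *)
Definition min_pairs (R : realType) (n : nat) (F : 'I_n.+1 -> 'I_n.+1 -> R) : R :=
  \big[Num.min/F ord0 ord_max]_(p : 'I_n.+1 * 'I_n.+1 | (p.1 < p.2)%N) F p.1 p.2.

(* Main.v *)
(** Call [m] the homogeneous weight, so that the weights [m (v |: tau)] sum to
    [m tau]: normalised by [m set0], [m] is the law of an ordered tuple of
    distinct vertices of a uniform top face.  By regularity each vertex is
    uniform on X(0), and |X(U_0,...,U_n)| = m(set0) P(v_i in U_i for all i).

    In the link of [tau], connectedness and the spectral gap say that the
    conditional mean of a function [g] given [tau] moves, when one more vertex
    is revealed, by at most lambda |g| in L^2.  Telescoping over the revealed
    vertices and applying Cauchy-Schwarz, the event v_k in B decouples from the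
    events v_i in U_i, i < k, up to k lambda sqrt(mu(A) mu(B)) for any A among
    the U_i.  Peeling off the sets one by one gives the error
    (1 + ... + n) lambda sqrt(mu(A) mu(B)), and n(n+1)/2 <= C_n. *)

Require Import Defs.
From mathcomp Require Import all_boot all_order all_algebra.
From mathcomp Require Import reals complex ring.

Set Implicit Arguments.
Unset Strict Implicit.
Unset Printing Implicit Defensive.

Import Order.TTheory GRing.Theory Num.Theory.

Local Open Scope ring_scope.

(** * Spectral norm bounds for Hermitian matrices, symmetric kernels and random walks *)

Section Hermitian.
Local Open Scope sesquilinear_scope.

Lemma mulmx_adjoint_diag (C : numClosedFieldType) (n : nat) (y : 'rV[C]_n) :
  (y *m y^t*) 0 0 = \sum_i `|y 0 i| ^+ 2.
Proof. by rewrite mxE; apply: eq_bigr => i _; rewrite !mxE normCK. Qed.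

(** Multiplication by the unitary matrix [P] of the spectral theorem preserves the sum of squared
    moduli, so only the diagonal factor matters, and it scales each coordinate by at most [c]. *)
Lemma hermitian_norm_le (C : numClosedFieldType) (n : nat) (A : 'M[C]_n) (c : C) :
    A \is hermsymmx -> (forall i, `|spectral_diag A 0 i| <= c) ->
  forall x : 'rV[C]_n,
    \sum_i `|(x *m A) 0 i| ^+ 2 <= c ^+ 2 * \sum_i `|x 0 i| ^+ 2.
Proof.
move=> hermA dA x; set P := spectralmx A; set d := spectral_diag A in dA *.
have Punit : P \is unitarymx := spectral_unitarymx A.
have PP : P^t* *m P = 1%:M.
  by rewrite -invmx_unitary // mulVmx ?spectral_unit.
have defA : A = P^t* *m diag_mx d *m P.
  by rewrite -invmx_unitary //; apply/orthomx_spectralP/hermitian_normalmx.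
have normP (y : 'rV[C]_n) : \sum_i `|(y *m P) 0 i| ^+ 2 = \sum_i `|y 0 i| ^+ 2.
  rewrite -!mulmx_adjoint_diag trmx_mul map_mxM -mulmxA (mulmxA P).
  by rewrite (unitarymxP Punit) mul1mx.
have [y ->] : exists y, x = y *m P by exists (x *m P^t* ); rewrite -mulmxA PP mulmx1.
have -> : y *m P *m A = y *m diag_mx d *m P.
  by rewrite defA !mulmxA -(mulmxA y P) (unitarymxP Punit) mulmx1.
rewrite !normP mulr_sumr; apply: ler_sum => i _.
rewrite mul_mx_diag mxE normrM exprMn mulrC ler_wpM2r ?exprn_ge0 //.
by rewrite lerXn2r ?nnegrE // (le_trans _ (dA i)).
Qed.

End Hermitian.

(** Over [R[i]] the matrix becomes Hermitian. Its spectral values are real roots of a characteristic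
    polynomial with coefficients in [R], so they are eigenvalues of [A] over [R] and the hypothesis
    bounds them. *)
Lemma symmetric_norm_le (R : rcfType) (n : nat) (A : 'M[R]_n) (c : R) :
    A^T = A -> (forall a, eigenvalue A a -> `|a| <= c) ->
  forall x : 'rV[R]_n, \sum_i (x *m A) 0 i ^+ 2 <= c ^+ 2 * \sum_i x 0 i ^+ 2.
Proof.
move=> symA specA x.
pose toC := real_complex R; pose AC := map_mx toC A.
have hermAC : AC \is hermsymmx.
  apply/is_hermitianmxP; rewrite expr0 scale1r.
  apply/matrixP=> i j; rewrite !mxE -[in LHS]symA mxE.
  by apply/esym; exact: conjc_real.
have dAC i : `|spectral_diag AC 0 i| <= toC c.
  have /mxOverP/(_ 0 i) /complex_realP[a da] := hermitian_spectral_diag_real hermAC.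
  have eigC : eigenvalue AC (toC a).
    apply/eigenvalueP; exists (row i (spectralmx AC)).
      have /orthomx_spectralP := hermitian_normalmx hermAC.
      move=> /(congr1 (fun B => row i (spectralmx AC *m B))).
      rewrite !mulmxA mulmxV ?spectral_unit // mul1mx => defA.
      rewrite -row_mul defA; apply/rowP=> j.
      by rewrite mul_diag_mx !mxE da.
    (* A row of a unitary matrix has norm 1, hence is not zero. *)
    apply/negP => /eqP row0; have /row_unitarymxP/(_ i i) := spectral_unitarymx AC.
    by rewrite row0 linear0l eqxx => /esym/eqP; rewrite oner_eq0.
  have eigR : eigenvalue A a.
    move: eigC; rewrite !eigenvalue_root_char /root -map_char_poly.
    by rewrite horner_map /= fmorph_eq0.
  rewrite da; have := specA _ eigR.
  by rewrite -lecR normc_def /= expr0n addr0 sqrtr_sqr.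
have := hermitian_norm_le hermAC dAC (map_mx toC x).
rewrite -map_mxM.
have sqC (y : 'rV[R]_n) : \sum_i `|map_mx toC y 0 i| ^+ 2 = toC (\sum_i y 0 i ^+ 2).
  rewrite /toC rmorph_sum /=; apply: eq_bigr => i _.
  by rewrite mxE -add_Re2_Im2 /= expr0n addr0 .
by rewrite !sqC /toC -rmorphXn -rmorphM lecR.
Qed.

Lemma symmetric_kernel_norm_le (R : rcfType) (T : finType) (S : T -> T -> R) (c : R) :
    (forall u v, S u v = S v u) ->
    (forall a (phi : T -> R), (exists v, phi v != 0) ->
       (forall v, \sum_u S u v * phi u = a * phi v) -> `|a| <= c) ->
  forall x : T -> R,
    \sum_v (\sum_u S u v * x u) ^+ 2 <= c ^+ 2 * \sum_v x v ^+ 2.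
Proof.
move=> symS specS x.
have sumE (F : T -> R) : \sum_v F v = \sum_(i < #|T|) F (enum_val i).
  by rewrite (reindex _ (onW_bij _ (enum_val_bij T))).
pose A : 'M[R]_#|T| := \matrix_(i, j) S (enum_val i) (enum_val j).
have mulA (y : 'rV[R]_#|T|) v :
    (y *m A) 0 (enum_rank v) = \sum_u S u v * y 0 (enum_rank u).
  rewrite mxE sumE; apply: eq_bigr => i _.
  by rewrite mxE enum_rankK enum_valK mulrC.
have symA : A^T = A by apply/matrixP=> i j; rewrite !mxE symS.
have specA a : eigenvalue A a -> `|a| <= c.
  case/eigenvalueP=> y yA /rV0Pn[i yi].
  apply: (specS a (fun v => y 0 (enum_rank v))).
    by exists (enum_val i); rewrite enum_valK.
  by move=> v; rewrite -mulA yA mxE.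
have := symmetric_norm_le symA specA (\row_i x (enum_val i)).
set y := \row_i _.
have yE v : y 0 (enum_rank v) = x v by rewrite mxE enum_rankK.
have sumyA : \sum_v (\sum_u S u v * x u) ^+ 2 = \sum_i (y *m A) 0 i ^+ 2.
  rewrite [LHS]sumE; apply: eq_bigr => i _.
  by rewrite -{2}(enum_valK i) mulA; under [in RHS]eq_bigr do rewrite yE.
have sumy : \sum_v x v ^+ 2 = \sum_i y 0 i ^+ 2.
  by rewrite [LHS]sumE; apply: eq_bigr => i _; rewrite mxE.
by rewrite sumyA sumy.
Qed.

(* Subtracting the rank one projection onto the constants from the
   symmetrised walk kernel removes exactly the eigenvalue 1. *)
Lemma walk_deviation_le (R : rcfType) (T : finType) (W : T -> T -> R) (c : R) :
    (forall u v, W u v = W v u) -> (forall u v, 0 <= W u v) ->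
    (forall v, 0 < \sum_u W u v) ->
    (forall phi : T -> R, (forall u v, W u v != 0 -> phi u = phi v) ->
       forall u v, phi u = phi v) ->
    0 <= c ->
    (forall a (phi : T -> R), (exists v, phi v != 0) ->
       (forall v, \sum_u W u v / (\sum_z W z v) * phi u = a * phi v) ->
       `|a| <= c \/ a = 1) ->
  forall g : T -> R,
    \sum_v (\sum_u W u v) *
      ((\sum_u W u v * g u) / (\sum_u W u v) -
       (\sum_u (\sum_z W z u) * g u) / (\sum_u \sum_z W z u)) ^+ 2
    <= c ^+ 2 * \sum_v (\sum_u W u v) * g v ^+ 2.
Proof.
move=> symW W0 w0 connW c0 specW g.
pose w v := \sum_u W u v; pose s v := Num.sqrt (w v).
rewrite -/(w _); pose tot := \sum_v w v.
have wpos v : 0 < w v := w0 v.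
have s0 v : 0 < s v by rewrite sqrtr_gt0.
have sN0 v : s v != 0 by rewrite gt_eqF.
have ss v : s v * s v = w v by rewrite -expr2 sqr_sqrtr // ltW.
have [v0 _|T0] := pickP (fun v : T => true); last first.
  have sum0 (F : T -> R) : \sum_v F v = 0 by apply: big_pred0.
  by rewrite [leLHS]sum0 [X in _ * X]sum0 mulr0.
have tot0 : 0 < tot.
  by rewrite /tot (bigD1 v0) //= ltr_pwDl ?sumr_ge0 // => v _; exact: ltW.
have totN0 : tot != 0 by rewrite gt_eqF.
(* Conjugating the walk by [s], the square root of the stationary weight, makes it symmetric and
   sends constants to multiples of [s]. The subtracted term is the orthogonal projection onto [s],
   whose squared norm is [tot]. *)
pose S u v := W u v / (s u * s v) - s u * s v / tot.
have symS u v : S u v = S v u by rewrite /S symW (mulrC (s u)).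
have Ss v : \sum_u S u v * s u = 0.
  under eq_bigr => u _.
    rewrite (_ : S u v * s u = W u v / s v - s v / tot * w u); last first.
      by rewrite /S -ss; field; rewrite !sN0 totN0.
    over.
  rewrite sumrB -mulr_suml -mulr_sumr -/tot -/(w v) -ss.
  by field; rewrite sN0 totN0.
have specS a (phi : T -> R) : (exists v, phi v != 0) ->
    (forall v, \sum_u S u v * phi u = a * phi v) -> `|a| <= c.
  move=> phiN0 Sphi.
  have [->|aN0] := eqVneq a 0; first by rewrite normr0.
  (* [S] is symmetric and kills [s], so an eigenvector with nonzero eigenvalue is orthogonal to [s].
     The projection vanishes on it, and [phi / s] is an eigenvector of the walk itself. *)
  have orth : \sum_v s v * phi v = 0.
    apply: (mulfI aN0); rewrite mulr0 mulr_sumr.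
    under eq_bigr => v _ do rewrite mulrCA -Sphi mulr_sumr.
    rewrite exchange_big big1 // => u _ /=.
    under eq_bigr => v _ do rewrite symS mulrA (mulrC (s v)).
    by rewrite -mulr_suml Ss mul0r.
  have Wphi v : \sum_u W u v / w v * (phi u / s u) = a * (phi v / s v).
    rewrite mulrA -Sphi.
    under [in RHS]eq_bigr => u _.
      rewrite (_ : S u v * phi u
        = W u v / (s u * s v) * phi u - s v / tot * (s u * phi u)); last first.
        by rewrite /S; field; rewrite !sN0 totN0.
      over.
    rewrite sumrB -mulr_sumr orth mulr0 subr0 mulr_suml.
    by apply: eq_bigr => u _; rewrite -ss; field; rewrite !sN0.
  have [|//|a1] := specW a (fun v => phi v / s v) _ Wphi.
    by case: phiN0 => v pv; exists v; rewrite mulf_neq0 ?invr_eq0.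
  pose psi v := phi v / s v.
  have psiw v : \sum_u W u v * psi u = w v * psi v.
    rewrite /psi -[phi v / _]mul1r -a1 -Wphi mulr_sumr.
    by apply: eq_bigr => u _; rewrite -ss; field; rewrite !sN0.
  (* Eigenvalue 1 remains to be excluded. A harmonic [psi] has zero Dirichlet energy, hence is
     constant along edges, and so everywhere by [connW]. *)
  have dir0 : \sum_v \sum_u W u v * (psi u - psi v) ^+ 2 = 0.
    have e1 : \sum_v \sum_u W u v * psi u ^+ 2 = \sum_v w v * psi v ^+ 2.
      rewrite exchange_big /=; apply: eq_bigr => u _; rewrite -mulr_suml.
      by congr (_ * _); apply: eq_bigr => v _.
    have e2 : \sum_v \sum_u W u v * psi v ^+ 2 = \sum_v w v * psi v ^+ 2.
      by apply: eq_bigr => v _; rewrite -mulr_suml.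
    have e3 : \sum_v \sum_u W u v * (psi u * psi v) = \sum_v w v * psi v ^+ 2.
      apply: eq_bigr => v _; under eq_bigr => u _ do rewrite mulrA.
      by rewrite -mulr_suml psiw expr2 mulrA.
    transitivity (\sum_v (\sum_u W u v * psi u ^+ 2 + \sum_u W u v * psi v ^+ 2
       - 2 * \sum_u W u v * (psi u * psi v))).
      apply: eq_bigr => v _; rewrite mulr_sumr -big_split -sumrB /=.
      by apply: eq_bigr => u _; ring.
    by rewrite sumrB big_split /= -mulr_sumr e1 e2 e3; ring.
  have psiE u v : psi u = psi v.
    apply: connW => {}u {}v Wuv.
    have term0 x y : 0 <= W x y * (psi x - psi y) ^+ 2 by rewrite mulr_ge0 ?sqr_ge0.
    have := psumr_eq0P (fun y _ => sumr_ge0 _ (fun x _ => term0 x y)) dir0.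
    move=> /(_ v isT) /(psumr_eq0P (fun x _ => term0 x v)) /(_ u isT) /eqP.
    by rewrite mulf_eq0 (negPf Wuv) sqrf_eq0 subr_eq0 => /eqP.
  (* For constant [psi], orthogonality to [s] reads [tot * psi v = 0], so [phi] vanishes. *)
  case: phiN0 => v /negP[]; rewrite -(mulfVK (sN0 v) (phi v)) -/(psi v).
  rewrite mulf_eq0 (negPf (sN0 v)) orbF -(mulrI_eq0 _ (mulfI totN0)) mulr_suml.
  rewrite -[X in _ == X]orth; apply/eqP/eq_bigr => u _.
  by rewrite (psiE v u) /psi -ss; field.
(* In the coordinates [s * g] the weighted norms become plain sums of squares. *)
rewrite [leLHS](_ : _ = \sum_v (\sum_u S u v * (s u * g u)) ^+ 2).
  rewrite [X in _ * X](_ : _ = \sum_v (s v * g v) ^+ 2).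
    exact: symmetric_kernel_norm_le. 
  by apply: eq_bigr => v _; rewrite exprMn (expr2 (s v)) ss.
apply: eq_bigr => v _; rewrite -/(w v) -ss; set B := _ / tot.
rewrite (_ : \sum_u S u v * (s u * g u)
           = s v * ((\sum_u W u v * g u) / (s v * s v) - B)).
  by rewrite exprMn (expr2 (s v)).
have -> : \sum_u S u v * (s u * g u)
    = \sum_u (W u v * g u / s v - s v / tot * (w u * g u)).
  by apply: eq_bigr => u _; rewrite -ss /S; field; rewrite !sN0 totN0.
rewrite sumrB -mulr_suml -mulr_sumr /B -/w.
by field; rewrite sN0 totN0.
Qed.

(** * Homogeneous weight and the structure of links *)

Section Weights.
Variables (V : finType) (X : {set {set V}}) (n : nat).
Implicit Types (s tau : {set V}).

(** Double counting of pairs [v], [s]. It serves once with [A] the whole of [V], for the additivity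
    of the weight, and once with [A] one of the sets of a transversal. *)
Lemma sum_supersets_exchange (tau A : {set V}) (f : {set V} -> nat) :
  (\sum_(v in A | v \notin tau) \sum_(s in faces X n.+1 | v |: tau \subset s) f s
   = \sum_(s in faces X n.+1 | tau \subset s) #|(A :\: tau) :&: s| * f s)%N.
Proof.
rewrite (exchange_big_dep (fun s => (s \in faces X n.+1) && (tau \subset s))) /=.
  apply: eq_bigr => s /andP[sX taus]; rewrite -sum_nat_const.
  apply: eq_bigl => v.
  rewrite subUset sub1set taus sX andbT !inE.
  by rewrite andTb (andbC (v \notin tau)).
by move=> v s _ /andP[-> /(subset_trans _)->] //; exact: subsetUr.
Qed.

(** A top face containing [tau] arises from each of its [n.+1 - #|tau|] other vertices, which is the
    factor between the two factorials. *)
Lemma weight_sum tau : (#|tau| <= n)%N ->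
  (\sum_(v | v \notin tau) weight X n (v |: tau) = weight X n tau)%N.
Proof.
move=> tau_n; rewrite /weight.
have count s : (#|[set t in faces X n.+1 | s \subset t]|
    = \sum_(t in faces X n.+1 | s \subset t) 1)%N.
  by rewrite -sum1_card; apply: eq_bigl => t; rewrite inE.
under eq_bigr => v vtau do rewrite cardsU1 vtau add1n subSS count.
rewrite -big_distrr /= (eq_bigl (fun v => (v \in setT) && (v \notin tau))); last first.
  by move=> v; rewrite inE.
rewrite sum_supersets_exchange subSn // factS count.
rewrite (mulnC _.+1) -mulnA; congr (_ * _)%N.
rewrite big_distrr /=; apply: eq_bigr => s /andP[]; rewrite inE => /andP[_ /eqP cs] taus.
rewrite !muln1 setTD setIC -setDE cardsD (setIidPr taus) cs.
by rewrite subSn.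
Qed.

Hypotheses (hX : simplicial_complex X) (hpure : pure_dim X n).

Lemma weight_gt0 tau : (0 < weight X n tau)%N = (tau \in X).
Proof.
rewrite /weight muln_gt0 fact_gt0 card_gt0; apply/set0Pn/idP => [[s]|tauX].
  rewrite !inE => /andP[/andP[sX _] taus].
  by case: hX => _; apply; [exact: sX|].
by have [s sX taus] := hpure tauX; exists s; rewrite inE sX.
Qed.

Lemma weight_eq0 tau : tau \notin X -> weight X n tau = 0%N.
Proof. by rewrite -weight_gt0 lt0n negbK => /eqP. Qed.

Lemma sub_complex s t : t \in X -> s \subset t -> s \in X.
Proof. by case: hX => _; apply. Qed.

Lemma vertex_linkE tau v : tau \in X ->
  (v \in vertices (link X tau)) = (v \notin tau) && (v |: tau \in X).
Proof.
move=> tauX; rewrite !inE !cards1 eqxx andbT (setUC tau) cardsU1 (addnC #|tau|) eqn_add2r.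
case: (v \in tau); rewrite ?andbF //= andbT.
by apply/idP/idP => [/andP[]//|h]; rewrite h (sub_complex h (subsetUl _ _)).
Qed.

Lemma edge_linkE tau u v : tau \in X -> v \in vertices (link X tau) ->
  ([set u; v] \in faces (link X tau) 2)
  = (u \notin v |: tau) && (u |: (v |: tau) \in X).
Proof.
move=> tauX; rewrite vertex_linkE // => /andP[vtau vX].
have [->|uv] := eqVneq u v; first by rewrite !inE cards2 eqxx !andbF.
rewrite !inE cards2 uv (negPf uv) (setUC tau) -setUA andbT /= cardsU1 cardsU1 vtau (addnC #|tau|).
have [utau|utau] := boolP (u \in tau).
  by rewrite !inE utau orbT /= add0n eqn_add2r !andbF.
rewrite !inE (negPf uv) (negPf utau) addnA eqxx andbT /=.
apply/idP/idP => [/andP[]//|h]; rewrite h andbT.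
apply: sub_complex h _; apply/subsetP => x; rewrite !inE.
by case/orP=> ->; rewrite ?orbT.
Qed.
End Weights.

(** * The spectral gap as an L^2 bound on conditional means *)

Section LinkDeviation.
Variables (R : realType) (V : finType) (X : {set {set V}}) (n : nat).
Hypotheses (hX : simplicial_complex X) (hpure : pure_dim X n).
Implicit Types (tau : {set V}) (g : V -> R).

(** Unnormalised conditional expectation of [g] at the next vertex, given [tau]. The weight vanishes
    off the complex, so the sum can run over [V] and make sense for every set [tau]. *)
Definition link_sum tau g : R :=
  \sum_(u | u \notin tau) (weight X n (u |: tau))%:R * g u.

Definition link_mean tau g : R := link_sum tau g / (weight X n tau)%:R.

Lemma link_sum1 tau : (#|tau| <= n)%N ->
  link_sum tau (fun=> 1) = (weight X n tau)%:R.
Proof.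
move=> tau_n; rewrite -(weight_sum X tau_n) natr_sum.
by apply: eq_bigr => u _; rewrite mulr1.
Qed.

Lemma link_sum_sub tau g : tau \in X ->
  link_sum tau g
  = \sum_(v : link_vertex X tau) (weight X n (val v |: tau))%:R * g (val v).
Proof.
move=> tauX; rewrite -(big_sub _ (fun v => (weight X n (v |: tau))%:R * g v)).
rewrite /link_sum [LHS]big_mkcond [RHS]big_mkcond; apply: eq_bigr => v _ /=.
rewrite vertex_linkE //; case: (v \notin tau) => //=.
by case: ifPn => // /weight_eq0->; rewrite ?mul0r.
Qed.

(** The diagonal is set to 0 because for [u = v] the union collapses to [v |: tau], whose weight is
    positive. *)
Definition link_kernel tau (u v : link_vertex X tau) : R :=
  if u == v then 0 else (weight X n (val u |: (val v |: tau)))%:R.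
Local Notation W := link_kernel.

(** One step of the walk on the link of [tau] from [v] thus averages over the link of [v |: tau].
    Vertices outside the link of [tau] contribute nothing, by closure under subsets. *)
Lemma link_kernel_sum tau g (v : link_vertex X tau) : tau \in X ->
  \sum_u W u v * g (val u) = link_sum (val v |: tau) g.
Proof.
move=> tauX; have := valP v; rewrite vertex_linkE // => /andP[vtau vX].
rewrite /link_sum (bigID (fun u => u \in vertices (link X tau))) /=.
rewrite [X in _ = _ + X]big1 ?addr0 => [|u /andP[]]; last first.
  rewrite in_setU1 negb_or => /andP[_ utau]; rewrite vertex_linkE // utau /=.
  move=> uX; rewrite weight_eq0 ?mul0r //; apply: contra uX => uvX.
  by apply: (sub_complex hX uvX); rewrite setUS ?subsetUr.
rewrite (eq_bigl (fun u => (u \in vertices (link X tau)) && (u != val v))); last first.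
  move=> u; rewrite andbC; case: (boolP (u \in vertices _)) => //=.
  by rewrite vertex_linkE // => /andP[utau _]; rewrite !inE negb_or utau andbT.
rewrite (big_sub_cond _ (fun u => u != val v)
  (fun u => (weight X n (u |: (val v |: tau)))%:R * g u)).
rewrite [RHS]big_mkcond; apply: eq_bigr => u _.
by rewrite /W -val_eqE; case: eqP; rewrite ?mul0r.
Qed.

Lemma link_kernel_weight tau (v : link_vertex X tau) :
  tau \in X -> (#|tau| < n)%N -> \sum_u W u v = (weight X n (val v |: tau))%:R.
Proof.
move=> tauX tau_n; rewrite -link_sum1; last first.
  by rewrite cardsU1 (leq_trans _ tau_n) //; case: (_ \notin _).
rewrite -link_kernel_sum //; apply: eq_bigr => u _.
by rewrite mulr1.
Qed.

Lemma link_kernel_edge tau (u v : link_vertex X tau) : tau \in X ->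
  ([set val u; val v] \in faces (link X tau) 2) = (W u v != 0).
Proof.
move=> tauX; rewrite edge_linkE ?(valP v) // /W.
have [->|uv] := eqVneq u v; first by rewrite !inE !eqxx.
rewrite pnatr_eq0 -lt0n weight_gt0 // in_setU1 (negPf (_ : val u != val v)) //=.
by have := valP u; rewrite vertex_linkE // => /andP[->].
Qed.

(** [link_kernel] normalised by its row sums is the kernel of [walk]: it vanishes off the edges of
    the link, and its row sum at [v] is the weight of [v |: tau]. *)
Lemma link_walk_spectrum tau (a : R) (phi : link_vertex X tau -> R) :
  tau \in X -> (#|tau| < n)%N -> (exists v, phi v != 0) ->
  (forall v, \sum_u W u v / (\sum_z W z v) * phi u = a * phi v) ->
  walk_spectrum X n tau a.
Proof.
move=> tauX tau_n [v0 phiv0] phiE; rewrite /walk_spectrum /passmx.leigenvalue.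
pose f : {ffun link_vertex X tau -> R^o} := [ffun v => phi v].
apply: contra_neq phiv0 => E0.
suff /ffunP/(_ v0) : f = 0 by rewrite !ffunE.
apply/eqP; rewrite -memv0 -E0 memv_ker !lfunE /= !lfunE /= lfunE /= subr_eq0.
apply/eqP/ffunP => v; rewrite !ffunE; transitivity (a * phi v); last by rewrite id_lfunE ffunE.
rewrite -phiE big_mkcond /=.
apply: eq_bigr => u _; rewrite !ffunE link_kernel_edge // link_kernel_weight //.
case: ifPn => [Wuv|/negPn/eqP->]; last by rewrite !mul0r.
congr (_ / _ * _); last by rewrite /link_weight setUC.
move: Wuv; rewrite /W; case: ifP; rewrite ?eqxx // => _ _.
by rewrite /link_weight setUC setUA.
Qed.

(** The mean given [v |: tau] is the walk applied to [g] at [v], and the mean given [tau] is the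
    stationary mean, so [walk_deviation_le] applies. For [tau] outside [X] both sides are 0. *)
Lemma link_mean_deviation tau (c : R) g :
    (#|tau| < n)%N -> 0 <= c ->
    (tau \in X -> connected_skeleton (link X tau)) ->
    (forall a : R, tau \in X -> walk_spectrum X n tau a -> `|a| <= c \/ a = 1) ->
  link_sum tau (fun v => (link_mean (v |: tau) g - link_mean tau g) ^+ 2)
  <= c ^+ 2 * link_sum tau (fun v => g v ^+ 2).
Proof.
move=> tau_n c0 conn spec.
have [tauX|tauX] := boolP (tau \in X); last first.
  have sum0 h : link_sum tau h = 0.
    apply: big1 => v _; rewrite weight_eq0 ?mul0r //.
    by apply: contra tauX => /(sub_complex hX); apply; exact: subsetUr.
  by rewrite !sum0 mulr0.
have symW (u v : link_vertex X tau) : W u v = W v u.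
  by rewrite /W eq_sym setUCA.
have wE (v : link_vertex X tau) := link_kernel_weight v tauX tau_n.
have totE : \sum_(v : link_vertex X tau) (weight X n (val v |: tau))%:R
            = (weight X n tau)%:R :> R.
  rewrite -link_sum1 1?ltnW // link_sum_sub //.
  by apply: eq_bigr => v _; rewrite mulr1.
have meanE : (\sum_(u : link_vertex X tau) (\sum_z W z u) * g (val u))
    / (\sum_(u : link_vertex X tau) \sum_z W z u) = link_mean tau g.
  rewrite /link_mean -totE link_sum_sub //.
  by congr (_ / _); apply: eq_bigr => u _; rewrite wE.
have -> : link_sum tau (fun v => (link_mean (v |: tau) g - link_mean tau g) ^+ 2)
    = \sum_(v : link_vertex X tau) (\sum_u W u v)
        * ((\sum_u W u v * g (val u)) / (\sum_u W u v) - link_mean tau g) ^+ 2.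
  rewrite link_sum_sub //; apply: eq_bigr => v _.
  by rewrite link_kernel_sum // wE.
have -> : link_sum tau (fun v => g v ^+ 2)
    = \sum_(v : link_vertex X tau) (\sum_u W u v) * g (val v) ^+ 2.
  by rewrite link_sum_sub //; apply: eq_bigr => v _; rewrite wE.
rewrite -meanE; apply: (@walk_deviation_le R _ (@link_kernel tau) c _ _ _ _ _ _ (fun v => g (val v))) => //.
- by move=> u v; rewrite /W; case: ifP.
- move=> v; rewrite wE ltr0n weight_gt0 //.
  by have := valP v; rewrite vertex_linkE // => /andP[].
- move=> phi phiW u v.
  have /connectP[p pp /esym vE] := conn tauX _ _ (valP u) (valP v).
  elim: p u pp vE => [|x p IHp] u /=; first by move=> _ /val_inj->.
  case/andP=> ux pp vE.
  (* [adjacent] relates points of [V]; closure under subsets keeps the path among the link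
     vertices. *)
  have xX : x \in vertices (link X tau).
    move: ux; rewrite /adjacent setUC edge_linkE ?(valP u) // vertex_linkE //.
    rewrite in_setU1 negb_or -andbA => /and3P[_ -> /(sub_complex hX)-> //=].
    by rewrite setUS ?subsetUr.
  have := IHp (Sub x xX) pp vE => <-.
  by apply: phiW; rewrite -link_kernel_edge.
by move=> a phi phi0 phiE; apply: spec => //; exact: link_walk_spectrum phiE.
Qed.
End LinkDeviation.

(** Cauchy-Schwarz for the square roots of [a] and [b], proved by Lagrange's identity. *)
Lemma sum_sqrt_le (R : rcfType) (I : finType) (P : pred I) (a b : I -> R) :
    (forall i, P i -> 0 <= a i) -> (forall i, P i -> 0 <= b i) ->
  \sum_(i | P i) Num.sqrt (a i * b i)
  <= Num.sqrt ((\sum_(i | P i) a i) * (\sum_(i | P i) b i)).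
Proof.
move=> a0 b0; pose x i := Num.sqrt (a i); pose y i := Num.sqrt (b i).
have -> : \sum_(i | P i) Num.sqrt (a i * b i) = \sum_(i | P i) x i * y i.
  by apply: eq_bigr => i Pi; rewrite sqrtrM ?a0.
have -> : \sum_(i | P i) a i = \sum_(i | P i) x i ^+ 2.
  by apply: eq_bigr => i Pi; rewrite sqr_sqrtr ?a0.
have -> : \sum_(i | P i) b i = \sum_(i | P i) y i ^+ 2.
  by apply: eq_bigr => i Pi; rewrite sqr_sqrtr ?b0.
apply: (le_trans (ler_norm _)); rewrite -sqrtr_sqr; apply: ler_wsqrtr.
rewrite -subr_ge0 -(pmulr_rge0 _ (ltr0n R 2)).
have <- : \sum_(i | P i) \sum_(j | P j) (x i * y j - x j * y i) ^+ 2
        = 2 * ((\sum_(i | P i) x i ^+ 2) * (\sum_(i | P i) y i ^+ 2)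
               - (\sum_(i | P i) x i * y i) ^+ 2).
  transitivity (\sum_(i | P i) (x i ^+ 2 * (\sum_(j | P j) y j ^+ 2)
     + (\sum_(j | P j) x j ^+ 2) * y i ^+ 2
     - 2 * (x i * y i * \sum_(j | P j) x j * y j))).
    apply: eq_bigr => i _; rewrite mulr_suml !mulr_sumr -big_split -sumrB /=.
    by apply: eq_bigr => j _; ring.
  by rewrite sumrB big_split /= -!mulr_suml -!mulr_sumr -mulr_suml; ring.
by apply: sumr_ge0 => i _; apply: sumr_ge0 => j _; exact: sqr_ge0.
Qed.

(** * Masses of transversal tuples and decoupling of the last vertex *)

Section TransversalMass.
Variables (R : realType) (V : finType) (X : {set {set V}}) (n : nat).
Implicit Types (tau U B : {set V}) (Us : seq {set V}) (g : V -> R).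
Local Notation m tau := (weight X n tau)%:R.
Local Notation link_sum := (@link_sum R V X n).
Local Notation link_mean := (@link_mean R V X n).

(** Up to normalisation, the probability that the vertices revealed after [tau] fall successively
    into the sets of [Us], any further vertices being left free. *)
Fixpoint transversal_mass tau Us : R :=
  if Us is U :: Us' then \sum_(v in U | v \notin tau) transversal_mass (v |: tau) Us'
  else m tau.
Local Notation F := transversal_mass.

Definition indic U : V -> R := fun v => (v \in U)%:R.

Lemma link_sum_indic tau U :
  link_sum tau (indic U) = \sum_(v in U | v \notin tau) m (v |: tau).
Proof.
rewrite /link_sum [RHS]big_mkcondl; apply: eq_bigr => v _.
by rewrite /indic; case: (v \in U); rewrite ?mulr1 ?mulr0.
Qed.

Lemma transversal_mass_ge0 tau Us : 0 <= F tau Us.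
Proof. by elim: Us tau => //= U Us IH tau; apply: sumr_ge0. Qed.

Lemma link_sum_ge0 tau g : (forall v, 0 <= g v) -> 0 <= link_sum tau g.
Proof. by move=> g0; apply: sumr_ge0 => v _; rewrite mulr_ge0. Qed.

Lemma indic_ge0 U v : 0 <= indic U v. Proof. exact: ler0n. Qed.
Hint Resolve transversal_mass_ge0 indic_ge0 : core.

Lemma cards_link_lt tau (v : V) k : (#|tau| + k.+1 <= n)%N -> (#|v |: tau| + k <= n)%N.
Proof.
by move=> le; rewrite cardsU1 (leq_trans _ le) // addnS -addSn leq_add2r; case: (_ \notin _).
Qed.

(** Exchangeability: the second vertex revealed after [tau] has the same law as the first. *)
Lemma link_sum_iter tau g : (#|tau| < n)%N ->
  \sum_(v | v \notin tau) link_sum (v |: tau) g = link_sum tau g.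
Proof.
move=> tau_n; rewrite /link_sum (exchange_big_dep (fun u => u \notin tau)) /=; last first.
  by move=> v u _; rewrite in_setU1 negb_or => /andP[].
apply: eq_bigr => u utau; rewrite -mulr_suml; congr (_ * _).
rewrite -[in RHS]weight_sum; last by have := @cards_link_lt tau u 0; rewrite addn1 addn0; apply.
rewrite natr_sum; apply: eq_big => [v|v _]; last by rewrite setUCA.
by rewrite !in_setU1 !negb_or (negPf utau) eq_sym andbT andbC.
Qed.

Lemma link_sum_iter_le tau g (P : pred V) : (forall v, 0 <= g v) -> (#|tau| < n)%N ->
  \sum_(v | P v && (v \notin tau)) link_sum (v |: tau) g <= link_sum tau g.
Proof.
move=> g0 tau_n; rewrite -(link_sum_iter g tau_n) big_mkcondl.
by apply: ler_sum => v _; case: (P v) => //; exact: link_sum_ge0.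
Qed.

Lemma link_sum_indic_le tau U : (#|tau| <= n)%N -> link_sum tau (indic U) <= m tau.
Proof.
move=> tau_n; rewrite -link_sum1 //; apply: ler_sum => v _; rewrite ler_wpM2l //.
by rewrite /indic; case: (_ \in _).
Qed.

Lemma transversal_mass_le tau Us : (#|tau| + size Us <= n.+1)%N -> F tau Us <= m tau.
Proof.
elim: Us tau => //= U Us IH tau le.
have tau_n : (#|tau| <= n)%N.
  by rewrite -ltnS (leq_trans _ le) // addnS ltnS leq_addr.
apply: le_trans (link_sum_indic_le U tau_n); rewrite link_sum_indic.
apply: ler_sum => v /andP[_ vtau]; apply: IH.
by rewrite cardsU1 vtau add1n addSn -addnS.
Qed.

(** All constraints except the one by [U] are dropped, and exchangeability moves that one to the
    first vertex. *)
Lemma transversal_mass_mem_le tau Us U : (#|tau| + size Us <= n.+1)%N -> U \in Us ->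
  F tau Us <= link_sum tau (indic U).
Proof.
elim: Us tau => //= U' Us IH tau le.
have le' v : v \notin tau -> (#|v |: tau| + size Us <= n.+1)%N.
  by move=> vtau; rewrite cardsU1 vtau add1n addSn -addnS.
rewrite inE => /predU1P[->|UUs].
  rewrite link_sum_indic; apply: ler_sum => v /andP[_ vtau].
  exact/transversal_mass_le/le'.
apply: le_trans (link_sum_iter_le (mem U') (indic_ge0 U) _); last first.
  case: Us UUs {IH le'} le => // U1 Us _ /=; rewrite !addnS !ltnS => /(leq_trans _); apply.
  exact: leq_addr.
by apply: ler_sum => v /andP[_ vtau]; apply: IH => //; exact: le'.
Qed.

Variable c : R.
Hypotheses (c0 : 0 <= c)
  (deviation : forall tau g, (#|tau| < n)%N ->
     link_sum tau (fun v => (link_mean (v |: tau) g - link_mean tau g) ^+ 2)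
     <= c ^+ 2 * link_sum tau (fun v => g v ^+ 2)).

(* Revealing the vertices one at a time, the conditional mean of [indic B]
   moves by at most [c] in L^2 at each step. *)
Lemma transversal_mass_rcons B Us tau : (#|tau| + size Us <= n)%N ->
  `|F tau (rcons Us B) - F tau Us * link_mean tau (indic B)|
  <= (size Us)%:R * c * Num.sqrt (F tau Us * link_sum tau (indic B)).
Proof.
elim: Us tau => [|U Us IH] tau /= le.
  rewrite -link_sum_indic mul0r mul0r /link_mean mulrC.
  (* When the weight is 0, [link_mean] is 0 by the convention on division, and [link_sum] vanishes
     too, being at most the weight. *)
  have [m0|m0] := eqVneq (m tau : R) 0; last by rewrite mulfVK ?subrr ?normr0.
  have := link_sum_indic_le B (leq_trans (leq_addr _ _) le).
  rewrite m0 mulr0 subr0 => S0; have /eqP-> : link_sum tau (indic B) == 0.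
    by rewrite eq_le S0 link_sum_ge0.
  by rewrite normr0.
have tau_n : (#|tau| < n)%N by rewrite (leq_trans _ le) // addnS ltnS leq_addr.
set S := link_sum _ (indic B); set FU := \sum_(v in U | _) F _ Us.
set mu := link_mean tau (indic B).
(* The mean given [v |: tau] is inserted: the first sum falls to the induction hypothesis, the
   second to [deviation]. *)
have -> : \sum_(v in U | v \notin tau) F (v |: tau) (rcons Us B) - FU * mu
   = \sum_(v in U | v \notin tau) (F (v |: tau) (rcons Us B)
         - F (v |: tau) Us * link_mean (v |: tau) (indic B))
     + \sum_(v in U | v \notin tau) F (v |: tau) Us
         * (link_mean (v |: tau) (indic B) - mu).
  rewrite mulr_suml -sumrB -big_split /=; apply: eq_bigr => v _; ring.
rewrite -addn1 natrD mulrDl mulrDl mul1r; apply: (le_trans (ler_normD _ _)).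
apply: lerD.
  apply: le_trans (ler_norm_sum _ _ _) _.
  apply: (@le_trans _ _ (\sum_(v in U | v \notin tau) (size Us)%:R * c *
     Num.sqrt (F (v |: tau) Us * link_sum (v |: tau) (indic B)))).
    by apply: ler_sum => v _; apply: IH; exact: cards_link_lt.
  rewrite -mulr_sumr ler_wpM2l ?mulr_ge0 //.
  apply: le_trans (sum_sqrt_le _ _) _ => // [v _|]; first exact: link_sum_ge0.
  by rewrite ler_wsqrtr // ler_wpM2l ?sumr_ge0 // link_sum_iter_le.
pose d v := link_mean (v |: tau) (indic B) - mu.
apply: le_trans (ler_norm_sum _ _ _) _.
(* Writing the term as the square root of a product lets Cauchy-Schwarz split off one full factor of
   [F]; the other is then bounded by the weight. *)
rewrite (eq_bigr (fun v => Num.sqrt (F (v |: tau) Us * (F (v |: tau) Us * d v ^+ 2)))); last first.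
  move=> v _; rewrite mulrA -expr2 -exprMn sqrtr_sqr //.
apply: le_trans (sum_sqrt_le _ _) _ => // [v _|]; first by rewrite mulr_ge0 ?sqr_ge0.
rewrite -[c in leRHS]ger0_norm // -(sqrtr_sqr c) -sqrtrM ?sqr_ge0 //.
rewrite ler_wsqrtr // mulrCA ler_wpM2l ?sumr_ge0 //.
have := deviation (indic B) tau_n.
(* An indicator equals its square. *)
rewrite [X in c ^+ 2 * X](_ : _ = S); last first.
  by apply: eq_bigr => v _; rewrite /indic; case: (v \in B); rewrite ?expr1n ?expr0n.
apply: le_trans; rewrite /link_sum big_mkcondl; apply: ler_sum => v vtau.
case: (v \in U); last by rewrite mulr_ge0 ?sqr_ge0.
rewrite ler_wpM2r ?sqr_ge0 // transversal_mass_le //.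
by rewrite leqW // cards_link_lt.
Qed.

End TransversalMass.

(** * Peeling off the sets one by one *)

Section Mixing.
Variables (R : realType) (V : finType) (X : {set {set V}}) (n : nat).
Local Notation M := (weight X n set0)%:R.
Local Notation F := (@transversal_mass R V X n).
Local Notation mu U := (link_mean X n set0 (indic R U)).
Variable c : R.
Hypotheses (c0 : 0 <= c) (M0 : (0 : R) < M)
  (deviation : forall (tau : {set V}) (g : V -> R), (#|tau| < n)%N ->
     link_sum X n tau (fun v => (link_mean X n (v |: tau) g - link_mean X n tau g) ^+ 2)
     <= c ^+ 2 * link_sum X n tau (fun v => g v ^+ 2)).

Lemma density_ge0 (U : {set V}) : 0 <= mu U.
Proof. by rewrite /link_mean divr_ge0 // link_sum_ge0 // => v; exact: indic_ge0. Qed.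

Lemma density_le1 (U : {set V}) : mu U <= 1.
Proof. by rewrite ler_pdivrMr // mul1r link_sum_indic_le ?cards0. Qed.

Hint Resolve density_ge0 density_le1 : core.

Lemma density_le_sqrt (U : {set V}) : mu U <= Num.sqrt (mu U).
Proof.
rewrite -[leLHS]sqr_sqrtr // expr2; apply: ler_piMr; rewrite ?sqrtr_ge0 //.
by rewrite -[leRHS]sqrtr1 ler_wsqrtr.
Qed.

(** Decoupling [B] costs [size Us] times [c], with the mass of [Us] at most [M * mu A]. The earlier
    error is multiplied by [mu B], at most its square root, which supplies the second root. The
    coefficients add up by Pascal's rule. *)
Lemma mixing_step (Us : seq {set V}) (A B : {set V}) :
    (size Us <= n)%N -> A \in Us ->
    (forall U, U \in Us -> `|F set0 Us - M * \prod_(U <- Us) mu U|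
       <= 'C(size Us, 2)%:R * c * M * Num.sqrt (mu U)) ->
  `|F set0 (rcons Us B) - M * \prod_(U <- rcons Us B) mu U|
  <= 'C((size Us).+1, 2)%:R * c * M * Num.sqrt (mu A * mu B).
Proof.
move=> sizeUs AUs IH; rewrite big_rcons /=.
have M_mu U : link_sum X n set0 (indic R U) = M * mu U by rewrite mulrC mulfVK ?gt_eqF.
rewrite (_ : _ - _ = (F set0 (rcons Us B) - F set0 Us * mu B)
  + (F set0 Us - M * \prod_(U <- Us) mu U) * mu B); last by ring.
rewrite binS bin1 natrD (mulrDl _ _ c) (mulrDl _ _ M) (mulrDl _ _ (Num.sqrt _)) [leRHS]addrC.
apply: le_trans (ler_normD _ _) _; apply: lerD.
  apply: le_trans (transversal_mass_rcons c0 deviation B _) _; first by rewrite cards0.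
  rewrite -[leRHS]mulrA ler_wpM2l ?mulr_ge0 //.
  rewrite -[M in leRHS](ger0_norm (ltW M0)) -sqrtr_sqr -sqrtrM ?sqr_ge0 //.
  rewrite ler_wsqrtr // expr2 mulrACA -!M_mu ler_wpM2r //.
    by rewrite link_sum_ge0 // => v; exact: indic_ge0.
  by apply: transversal_mass_mem_le AUs; rewrite cards0 leqW.
rewrite normrM (ger0_norm (density_ge0 B)) sqrtrM // mulrA.
by apply: ler_pM => //; [exact: IH | exact: density_le_sqrt].
Qed.

Lemma transversal_mass_near (Us : seq {set V}) : (size Us <= n.+1)%N ->
  forall U, U \in Us -> `|F set0 Us - M * \prod_(U <- Us) mu U|
    <= 'C(size Us, 2)%:R * c * M * Num.sqrt (mu U).
Proof.
elim/last_ind: Us => [//|Us B IH]; rewrite size_rcons ltnS => sizeUs U.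
have IHUs := IH (leqW sizeUs).
have coef0 : 0 <= 'C((size Us).+1, 2)%:R * c * M :> R by rewrite !mulr_ge0 // ltW.
have sqrt_le A C : Num.sqrt (mu A * mu C) <= Num.sqrt (mu C).
  by rewrite ler_wsqrtr // ler_piMl.
rewrite mem_rcons inE => /predU1P[->|UUs]; last first.
  apply: le_trans (mixing_step B sizeUs UUs IHUs) _.
  by rewrite ler_wpM2l // mulrC.
(* A single set has no error, in accordance with ['C(1, 2) = 0]. *)
case: Us IHUs sizeUs coef0 {IH} => [|A Us] IHUs sizeUs coef0.
  rewrite big_seq1 /= -link_sum_indic mulrC mulfVK ?gt_eqF // subrr normr0.
  by rewrite bin_small // !mul0r.
apply: le_trans (mixing_step B sizeUs (mem_head A Us) IHUs) _.
by rewrite ler_wpM2l.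
Qed.

Lemma transversal_mass_mixing (Us : seq {set V}) (A B : {set V}) :
    (size Us <= n)%N -> A \in Us ->
  `|F set0 (rcons Us B) - M * \prod_(U <- rcons Us B) mu U|
  <= 'C((size Us).+1, 2)%:R * c * M * Num.sqrt (mu A * mu B).
Proof.
move=> sizeUs AUs; apply: mixing_step => //; apply: transversal_mass_near.
exact: leqW.
Qed.

End Mixing.

(** * From masses to numbers of transversal faces *)

Section Counting.
Variables (R : realType) (V : finType) (X : {set {set V}}) (n : nat).

(** Within a fixed top face [s], disjointness makes the choices of vertices independent, whence the
    product. The factorial orders the unconstrained vertices. *)
Lemma transversal_mass_disjoint (tau : {set V}) (Us : seq {set V}) :
    pairwise (fun A B : {set V} => [disjoint A & B]) Us ->
    all (fun U : {set V} => [disjoint U & tau]) Us ->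
  transversal_mass R X n tau Us
  = ((n.+1 - #|tau| - size Us)`! *
     \sum_(s in faces X n.+1 | tau \subset s) \prod_(U <- Us) #|U :&: s|)%:R.
Proof.
elim: Us tau => [|U Us IH] tau /=.
  move=> _ _; rewrite /weight subn0; congr _%:R; congr (_ * _)%N.
  by rewrite -sum1_card; apply: eq_big => [s|s _]; rewrite ?big_nil // !inE.
case/andP=> disjU disjUs /andP[Utau disjtau].
rewrite (eq_bigr (fun v => ((n.+1 - #|tau| - (size Us).+1)`! *
    \sum_(s in faces X n.+1 | v |: tau \subset s) \prod_(U <- Us) #|U :&: s|)%:R)).
  rewrite -natr_sum -big_distrr /= sum_supersets_exchange (setDidPl Utau).
  by under [in RHS]eq_bigr do rewrite big_cons.
move=> v /andP[vU vtau]; rewrite IH //.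
  by rewrite cardsU1 vtau add1n -subnDA addSnnS subnDA.
apply/allP => U' U'Us; rewrite -setI_eq0 setIUr setU_eq0 !setI_eq0.
rewrite (allP disjtau) // andbT disjoint_sym disjoints1; apply: contraL vU => vU'.
by have := disjointFl (allP disjU _ U'Us) vU' => ->.
Qed.

(** If no intersection is empty, [k] disjoint nonempty parts of a set of [k] elements must all be
    singletons; otherwise the product is 0. *)
Lemma prod_card_disjoint (k : nat) (U : 'I_k -> {set V}) (s : {set V}) :
    (forall i j, i != j -> [disjoint U i & U j]) -> #|s| = k ->
  (\prod_i #|U i :&: s| = [forall i, #|s :&: U i| == 1])%N.
Proof.
move=> disjU cards_s.
have sum_le : (\sum_i #|U i :&: s| <= \sum_(i < k) 1)%N.
  apply: (@leq_trans #|s|); last by rewrite sum1_card card_ord cards_s.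
  rewrite -[leqRHS]sum1_card.
  have cards_U i : #|U i :&: s| = (\sum_(x in s) (x \in U i))%N.
    rewrite -sum1_card (eq_bigl (fun x => (x \in s) && (x \in U i))) => [|x].
      by rewrite big_mkcondr; apply: eq_bigr => x _; case: (_ \in _).
    by rewrite inE andbC.
  under eq_bigr do rewrite cards_U.
  rewrite exchange_big /=; apply: leq_sum => x _.
  have [i xUi|noU] := pickP (fun i => x \in U i); last first.
    by rewrite big1 // => i _; rewrite noU.
  rewrite (bigD1 i) //= xUi big1 // => j ji.
  by rewrite (disjointFl (disjU _ _ ji) xUi).
have [/forallP all1|] := boolP [forall i, #|s :&: U i| == 1%N].
  by rewrite big1 // => i _; rewrite setIC; apply/eqP.
rewrite negb_forall => /existsP[i0 Ui0].
have [i /eqP Ui|no0] := pickP (fun i => #|U i :&: s| == 0)%N.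
  by rewrite (bigD1 i) //= Ui.
have ge1 i : (1 <= #|U i :&: s|)%N by rewrite lt0n no0.
case/negP: Ui0; rewrite setIC; apply/eqP/esym.
have [_] := leqif_sum (fun i (_ : true) => leqif_eq (ge1 i)).
rewrite eqn_leq sum_le andbT leq_sum // => /esym/forallP/(_ i0).
by move/eqP.
Qed.

(** Allowing any enumeration [r] of the indices makes it possible to put a prescribed set last. *)
Lemma transversal_mass_faces (U : 'I_n.+1 -> {set V}) (r : seq 'I_n.+1) :
    (forall i j, i != j -> [disjoint U i & U j]) ->
    perm_eq r (index_enum 'I_n.+1) ->
  transversal_mass R X n set0 [seq U i | i <- r] = #|transversal_faces X U|%:R.
Proof.
move=> disjU r_enum; have size_r : size r = n.+1.
  by rewrite (perm_size r_enum) -[RHS]card_ord cardE enumT.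
rewrite transversal_mass_disjoint; first 1 last.
- rewrite pairwise_map; apply: (@sub_pairwise _ [rel i j | i != j]) => [i j /disjU//|].
  by rewrite -uniq_pairwise (perm_uniq r_enum) index_enum_uniq.
- by apply/allP => A _; rewrite disjoint_sym disjoints_subset sub0set.
rewrite cards0 subn0 size_map size_r subnn mul1n; congr _%:R.
rewrite -sum1_card [RHS]big_mkcond [LHS]big_mkcond; apply: eq_bigr => s _.
rewrite sub0set andbT [in RHS]inE; case: ifP => //= sX.
rewrite big_map (perm_big _ r_enum) prod_card_disjoint //.
by move: sX; rewrite inE => /andP[_ /eqP].
Qed.
End Counting.

(** * Comparison of constants and conclusion *)

(** The comparison is termwise: with [a = k + 1] and [p = n - k >= 1], the term
    [a * ((a + 1)^p - a^p)] is at least [a], and these [a] sum to the binomial. *)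
Lemma bin2_le_mixing_constant (R : realType) (n : nat) :
  'C(n.+1, 2)%:R <= mixing_constant R n.
Proof.
rewrite -bin2_sum big_nat_recl //= add0n big_mkord natr_sum /mixing_constant.
apply: ler_sum => k _; have : (0 < n - k)%N by rewrite subn_gt0.
case: (n - k)%N => // j _; set a : R := k.+1%:R.
rewrite addn1 [a ^+ j.+2]exprS -mulrBr -[leLHS]mulr1 ler_wpM2l //.
have -> : k.+2%:R = a + 1 :> R by rewrite /a -natr1.
have a1 : 1 <= a + 1 by rewrite lerDr.
rewrite lerBrDl !exprS mulrDl mul1r lerD ?exprn_ege1 // ler_wpM2l //.
by rewrite lerXn2r ?nnegrE ?lerDl ?addr_ge0.
Qed.

(** Reduces a bound by the minimum to a bound for each pair of distinct indices; [0 < n] makes the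
    initial pair distinct. *)
Lemma min_pairs_attained (R : realType) (n : nat) (F : 'I_n.+1 -> 'I_n.+1 -> R) :
  (0 < n)%N -> exists i j, i != j /\ min_pairs F = F i j.
Proof.
move=> n0; rewrite /min_pairs.
elim/big_ind: _ => [|x y [i [j [ij ->]]] [k [l [kl ->]]]|[i j] /= ij].
- by exists ord0, ord_max; rewrite -val_eqE /= eq_sym -lt0n.
- by case: leP => _; [exists i, j | exists k, l].
- by exists i, j; rewrite -val_eqE /= neq_ltn ij.
Qed.

Unset Implicit Arguments.

Theorem corollary7p2 (R : realType) (V : finType) (n : nat) (hn : (1 <= n)%N)
    (X : {set {set V}}) (hX : simplicial_complex X) (hpure : pure_dim X n)
    (hconn : connected_links X n)
    (K : nat) (hreg : regular_complex X n K)
    (lambda : R) (hlambda0 : 0 < lambda) (hlambda1 : lambda < 1)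
    (hspec : forall k : nat, (k <= n - 1)%N ->
       forall tau : {set V}, tau \in faces X k ->
       forall a : R, walk_spectrum X n tau a ->
       (- lambda <= a <= lambda) \/ a = 1)
    (U : 'I_n.+1 -> {set V})
    (hU : forall i, U i \subset vertices X)
    (hdisj : forall i j, i != j -> [disjoint U i & U j]) :
  `| #|transversal_faces X U|%:R
     - n`!%:R * K%:R / #|vertices X|%:R ^+ n * \prod_(i < n.+1) #|U i|%:R |
    <= mixing_constant R n * n`!%:R * lambda * K%:R
       * min_pairs (fun i j => Num.sqrt (#|U i|%:R * #|U j|%:R))
  /\
  `| #|transversal_faces X U|%:R / #|faces X n.+1|%:R
     - (n.+1)`!%:R * (\prod_(i < n.+1) #|U i|%:R / #|vertices X|%:R ^+ n.+1) |
    <= mixing_constant R n * (n.+1)`!%:R * lambda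
       * min_pairs (fun i j =>
           Num.sqrt (#|U i|%:R * #|U j|%:R / #|vertices X|%:R ^+ 2)).
Proof.
pose N := #|vertices X|.
have wv v : weight X n (v |: set0) = (n`! * (if v \in vertices X then K else 0))%N.
  rewrite setU0; case: ifPn => [vX|vX].
    rewrite /weight cards1 subSS subn0 -(hreg _ vX); congr (_ * _)%N.
    by apply: eq_card => s; rewrite !inE sub1set.
  rewrite muln0; apply: weight_eq0 hX hpure _ _; apply: contra vX => vX.
  by rewrite !inE cards1 vX.
(* The total weight is computed through vertices and then through top faces. The first form scales
   the first estimate, the second form the other, and positivity makes all denominators nonzero. *)
have MN : weight X n set0 = (n`! * K * N)%N.
  rewrite -weight_sum ?cards0 //; under eq_bigr do rewrite wv.
  rewrite -big_distrr /= -mulnA; congr (_ * _)%N.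
  rewrite (eq_bigl xpredT) => [|v]; last by rewrite inE.
  by rewrite -big_mkcond sum_nat_const mulnC.
have MX : weight X n set0 = (n.+1`! * #|faces X n.+1|)%N.
  rewrite /weight cards0 subn0; congr (_ * _)%N.
  by apply: eq_card => s; rewrite inE sub0set andbT.
have M0 : (0 < weight X n set0)%N by rewrite weight_gt0 //; case: hX.
have := M0; rewrite {1}MN !muln_gt0 => /andP[/andP[_ K0] N0].
have := M0; rewrite {1}MX muln_gt0 => /andP[_ X0].
have mu i : link_mean X n set0 (indic R (U i)) = #|U i|%:R / N%:R.
  rewrite /link_mean link_sum_indic MN.
  have -> : \sum_(v in U i | v \notin set0) (weight X n (v |: set0))%:R
      = (n`! * K * #|U i|)%:R :> R.
    rewrite -natr_sum; congr _%:R.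
    rewrite (eq_big (mem (U i)) (fun=> n`! * K)%N) => [|v|v /andP[vU _]].
    - by rewrite sum_nat_const mulnC.
    - by rewrite inE andbT.
    - by rewrite wv (subsetP (hU i)).
  by rewrite !natrM; field; rewrite !pnatr_eq0 -!lt0n N0 K0 fact_gt0.
have lambda_ge0 := ltW hlambda0.
have dev (tau : {set V}) (g : V -> R) : (#|tau| < n)%N ->
    link_sum X n tau (fun v => (link_mean X n (v |: tau) g - link_mean X n tau g) ^+ 2)
    <= lambda ^+ 2 * link_sum X n tau (fun v => g v ^+ 2).
  move=> tau_n; apply: link_mean_deviation => // [tauX|a tauX tau_a].
    by apply: (hconn _ tau_n); rewrite inE tauX eqxx.
  case: (hspec #|tau| _ tau _ a tau_a) => [||aL|->]; [|by rewrite inE tauX eqxx|left|by right].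
    by rewrite leq_subRL // add1n.
  by rewrite ler_norml.
have bound i j : i != j ->
    `|#|transversal_faces X U|%:R - (weight X n set0)%:R * \prod_(k < n.+1) (#|U k|%:R / N%:R)|
    <= mixing_constant R n * lambda * (weight X n set0)%:R
       * Num.sqrt (#|U i|%:R / N%:R * (#|U j|%:R / N%:R)).
  (* The index [j] is enumerated last, so [U j] is the set peeled off and [U i] is among the earlier
     ones. *)
  move=> ij; pose r := rem j (index_enum 'I_n.+1).
  have r_perm : perm_eq (rcons r j) (index_enum 'I_n.+1).
    by rewrite perm_rcons perm_sym perm_to_rem // mem_index_enum.
  have size_r : size r = n.
    have size_enum : size (index_enum 'I_n.+1) = n.+1.
      by rewrite -[RHS]card_ord cardE enumT.
    by have := perm_size r_perm; rewrite size_rcons size_enum => -[].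
  have ir : i \in r.
    have : i \in rcons r j by rewrite (perm_mem r_perm) mem_index_enum.
    by rewrite mem_rcons inE (negPf ij).
  have := @transversal_mass_mixing R V X n lambda lambda_ge0 _ dev
            [seq U k | k <- r] (U i) (U j).
  rewrite ltr0n size_map size_r -map_rcons => /(_ M0 (leqnn n) (map_f U ir)).
  rewrite (transversal_mass_faces _ _ hdisj r_perm) big_map (perm_big _ r_perm) /= !mu.
  under eq_bigr do rewrite mu.
  move/le_trans; apply; rewrite !ler_wpM2r ?sqrtr_ge0 //.
  exact: bin2_le_mixing_constant.
have prodE : \prod_(k < n.+1) (#|U k|%:R / N%:R) = \prod_(k < n.+1) #|U k|%:R / N%:R ^+ n.+1 :> R.
  by rewrite prodf_div prodr_const card_ord.
have [NR KR XR] : [/\ N%:R != 0 :> R, K%:R != 0 :> R & #|faces X n.+1|%:R != 0 :> R].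
  by rewrite !pnatr_eq0 -!lt0n.
rewrite -/N; split.
  have [i [j [ij ->]]] := min_pairs_attained (fun i j => Num.sqrt (#|U i|%:R * #|U j|%:R : R)) hn.
  have := bound i j ij; rewrite prodE MN.
  rewrite (_ : (n`! * K * N)%:R * (_ / _) = n`!%:R * K%:R / N%:R ^+ n * \prod_(k < n.+1) #|U k|%:R); last first.
    by rewrite !natrM exprS; field; rewrite expf_neq0 // NR.
  move/le_trans; apply.
  have -> : Num.sqrt (#|U i|%:R / N%:R * (#|U j|%:R / N%:R))
      = Num.sqrt (#|U i|%:R * #|U j|%:R) / N%:R :> R.
    rewrite mulrACA -(expr2 N%:R^-1) [LHS]sqrtrM ?mulr_ge0 // sqrtr_sqr.
    by rewrite ger0_norm ?invr_ge0.
  by rewrite !natrM le_eqVlt; apply/orP; left; apply/eqP; field.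
have [i [j [ij ->]]] := min_pairs_attained
  (fun i j => Num.sqrt (#|U i|%:R * #|U j|%:R / N%:R ^+ 2 : R)) hn.
(* The second estimate is [bound] divided by the number of top faces. *)
rewrite (_ : _ - _ = (#|transversal_faces X U|%:R - (weight X n set0)%:R
    * \prod_(k < n.+1) (#|U k|%:R / N%:R)) / #|faces X n.+1|%:R); last first.
  by rewrite prodE MX natrM; field; rewrite XR expf_neq0.
rewrite normrM normfV normr_nat ler_pdivrMr ?ltr0n //.
apply: le_trans (bound i j ij) _; rewrite MX natrM.
have -> : #|U i|%:R / N%:R * (#|U j|%:R / N%:R)
    = #|U i|%:R * #|U j|%:R / N%:R ^+ 2 :> R by field.
by rewrite le_eqVlt; apply/orP; left; apply/eqP; ring.
Qed.
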